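(* Let $f=\frac1n\sum_{i=1}^n f_i$ be an $L$-smooth, $\mu$-strongly convex quadratic finite sum as described in the context, with $n\ge2$, $\kappa=L/\mu$ and minimizer $w^*$, and assume interpolation, i.e. $\nabla f_i(w^* )=0$ for all $i$. Let $0<a\le1$ be a constant and run stochastic heavy ball $$w_{k+1}=w_k-\alpha\nabla f_{ik}(w_k)+\beta(w_k-w_{k-1}),\qquad w_{-1}=w_0,$$ with $\alpha=\frac aL$, $\beta=\left(1-\frac12\sqrt{\alpha\mu}\right)^2$ and batch-size $b$ such that $b\ge b^*:=n\,\frac{1}{1+\frac{n-1}{C\kappa^2}}$, where $C:=3^52^6$. Then for every $T\ge1$, $$\mathbb{E}\|w_T-w^*\|\le\frac{6\sqrt2}{\sqrt a}\sqrt\kappa\,\exp\left(-\frac{T}{\sqrt\kappa}\,\frac{\sqrt a}{2}\max\left\{\frac34,\ 1-2\sqrt\kappa\sqrt\zeta\right\}\right)\|w_0-w^*\|,$$ where $\zeta=\sqrt{3\,\frac{n-b}{(n-1)b}}$.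
   Context: Setting: $f_i(w)=\frac12 w^TA_iw-\langle d_i,w\rangle$ on $\mathbb{R}^d$ with $A_i$ symmetric positive semi-definite; $f=\frac1n\sum_i f_i=\frac12 w^TAw-\langle d,w\rangle$ with $A=\frac1n\sum_iA_i$, $d=\frac1n\sum_i d_i$. Each $f_i$ is $L$-smooth with $L=\max_i\lambda_{\max}(A_i)$, and $\mu=\lambda_{\min}(A)>0$. At each iteration $k$ a mini-batch $B_k\subseteq\{1,\dots,n\}$ of size $b$ is sampled uniformly without replacement, independently across iterations, and $\nabla f_{ik}(w):=\frac1b\sum_{i\in B_k}\nabla f_i(w)$. $\mathbb{E}$ is over all mini-batches; $\|\cdot\|$ is the Euclidean norm. *)

(* Defs.v *)
From HB Require Import structures.
From mathcomp Require Import all_boot all_order all_algebra.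
From mathcomp Require Import all_classical all_reals all_analysis.
Set Implicit Arguments.
Unset Strict Implicit.
Unset Printing Implicit Defensive.
Import Order.TTheory GRing.Theory Num.Theory.
Import numFieldNormedType.Exports.
Local Open Scope classical_set_scope.
Local Open Scope ring_scope.

(* The library norm [`|v|] on matrices is the sup norm, hence this one. *)
Definition l2norm (R : realType) p (v : 'cV[R]_p) : R :=
  Num.sqrt (\sum_(j < p) v j 0 ^+ 2).

(* The coordinates are the directional derivatives along the standard basis. *)
Definition gradient (R : realType) p (f : 'cV[R]_p -> R) (w : 'cV[R]_p) :
    'cV[R]_p :=
  \col_(j < p) 'D_(delta_mx j 0) f w.

Definition quadratic (R : realType) p (A : 'M[R]_p) (c : 'cV[R]_p)
    (w : 'cV[R]_p) : R :=
  2^-1 * (w^T *m A *m w) 0 0 - (c^T *m w) 0 0.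

Definition sym_psd (R : realType) p (A : 'M[R]_p) : Prop :=
  A^T = A /\ forall x : 'cV[R]_p, 0 <= (x^T *m A *m x) 0 0.

(* The spectrum of a symmetric real matrix is finite, and nonempty when
   [0 < p]; [sup] and [inf] are then attained.  For [p = 0] both are 0. *)
Definition lambda_max (R : realType) p (A : 'M[R]_p) : R :=
  sup [set x : R | eigenvalue A x].
Definition lambda_min (R : realType) p (A : 'M[R]_p) : R :=
  inf [set x : R | eigenvalue A x].

Definition finite_sum (R : realType) p n (f : 'I_n -> 'cV[R]_p -> R)
    (w : 'cV[R]_p) : R :=
  n%:R^-1 * \sum_(i < n) f i w.

Definition minimizer (R : realType) p (f : 'cV[R]_p -> R) (w : 'cV[R]_p) :
    Prop :=
  forall v, f w <= f v.

Definition batch_gradient (R : realType) p n (f : 'I_n -> 'cV[R]_p -> R)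
    (b : nat) (B : {set 'I_n}) (w : 'cV[R]_p) : 'cV[R]_p :=
  b%:R^-1 *: \sum_(i in B) gradient (f i) w.

(* [g k] is the gradient oracle of iteration [k]; the state after [k] steps is
   the pair (w_k, w_{k-1}), started at (w_0, w_{-1}) with w_{-1} = w_0. *)
Fixpoint heavy_ball_state (R : realType) p (g : nat -> 'cV[R]_p -> 'cV[R]_p)
    (alpha beta : R) (w0 : 'cV[R]_p) (k : nat) : 'cV[R]_p * 'cV[R]_p :=
  if k is k'.+1 then
    let: (w, wprev) := heavy_ball_state g alpha beta w0 k' in
    (w - alpha *: g k' w + beta *: (w - wprev), w)
  else (w0, w0).

Definition heavy_ball (R : realType) p (g : nat -> 'cV[R]_p -> 'cV[R]_p)
    (alpha beta : R) (w0 : 'cV[R]_p) (k : nat) : 'cV[R]_p :=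
  (heavy_ball_state g alpha beta w0 k).1.

Section RandomBatches.
Context (disp : measure_display) (Om : measurableType disp) (R : realType).
Variable P : probability Om R.

(* The finite type [V] carries its discrete sigma-algebra. *)
Definition discrete_rv (V : finType) (X : Om -> V) : Prop :=
  forall E : set V, measurable (X @^-1` E).

Definition mutually_independent (V : finType) (X : nat -> Om -> V) : Prop :=
  forall (J : seq nat) (E : nat -> set V), uniq J ->
    P (\bigcap_(k in [set` J]) (X k @^-1` E k)) =
    (\prod_(k <- J) P (X k @^-1` E k))%E.

(* Uniform law on the [b]-element subsets of [{0, ..., n-1}]. *)
Definition uniform_without_replacement n (b : nat) (B : Om -> {set 'I_n}) :
    Prop :=
  forall S : {set 'I_n}, P (B @^-1` [set S]) =
    (if #|S| == b then ('C(n, b)%:R : R)^-1 else 0)%:E.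

Definition minibatch_sampling n (b : nat) (B : nat -> Om -> {set 'I_n}) :
    Prop :=
  [/\ forall k, discrete_rv (B k),
      forall k, uniform_without_replacement b (B k)
    & mutually_independent B].

End RandomBatches.

(* Main.v *)
Require Import Defs.
From HB Require Import structures.
From mathcomp Require Import all_boot all_order all_algebra.
From mathcomp Require Import all_classical all_reals all_analysis.
From mathcomp Require Import measurable_realfun ring lra.
Set Implicit Arguments.
Unset Strict Implicit.
Unset Printing Implicit Defensive.
Import Order.TTheory GRing.Theory Num.Theory.
Import numFieldNormedType.Exports.
Local Open Scope ring_scope.

(* By interpolation the error e_k = w_k - w^* obeys
     e_(k+1) = e_k - alpha A_(B_k) e_k + beta (e_k - e_(k-1)),
   and the quadratic form
     V(x, y) = |x|^2 - <x, ((1 + beta) I - alpha A) y> + beta |y|^2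
   is multiplied by exactly beta under the step with the mean matrix A.
   The batch noise is unbiased, so it adds to V only its variance, at most
   alpha^2 L^2 s |x|^2 with s = zeta^2 / 3 = (n - b) / ((n - 1) b).
   With q = sqrt (alpha mu) = sqrt (a / kappa), V dominates (11/64) q^2 |x|^2,
   hence E V contracts by beta + (64/33) q^2 z^4 at every iteration, where
   z = sqrt kappa sqrt zeta; the batch-size condition gives z <= 1/8, and this
   factor is then at most exp(- q (1 - 2 z)). *)

(** * The law of a uniform batch *)

Definition batch_law (R : realType) n (b : nat) (S : {set 'I_n}) : R :=
  if #|S| == b then ('C(n, b)%:R)^-1 else 0.
Arguments batch_law R {n} b S.

Lemma batch_law_ge0 (R : realType) n b (S : {set 'I_n}) : 0 <= batch_law R b S.
Proof. by rewrite /batch_law; case: ifP; rewrite ?invr_ge0 ?ler0n. Qed.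

(** The [b]-subsets that miss [D] are those of its complement. Taking [#|D|] equal to 0, 1 and 2
    gives the total mass and the one- and two-point exclusion probabilities. *)
Lemma batch_law_avoid (R : realType) n b (D : {set 'I_n}) :
  \sum_(S : {set 'I_n}) batch_law R b S * [disjoint S & D]%:R
  = 'C(n - #|D|, b)%:R / 'C(n, b)%:R.
Proof.
have -> : (n - #|D|)%N = #|~: D| by rewrite [#|~: D|]cardsCs finset.setCK card_ord.
rewrite -cards_draws -sum1_card natr_sum big_distrl /= [RHS]big_mkcond /=.
apply: eq_bigr => S _; rewrite inE mul1r finset.disjoints_subset /batch_law.
by case: (S \subset _); case: (_ == b); rewrite /= ?mulr1 ?mulr0.
Qed.

Lemma batch_law_sum1 (R : realType) n b : (b <= n)%N ->
  \sum_(S : {set 'I_n}) batch_law R b S = 1.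
Proof.
move=> bn; have := @batch_law_avoid R n b finset.set0.
rewrite cards0 subn0 divff ?pnatr_eq0 -?lt0n ?bin_gt0// => <-.
by apply: eq_bigr => S _; rewrite finset.disjoints_subset finset.setC0 finset.subsetT mulr1.
Qed.

Lemma batch_law_avoid1 (R : realType) n b (i : 'I_n) : (b <= n)%N ->
  \sum_(S : {set 'I_n}) batch_law R b S * (i \notin S)%:R = 1 - b%:R / n%:R.
Proof.
move=> bn; have := @batch_law_avoid R n b [set i].
under eq_bigr do rewrite disjoint_sym disjoints1.
move=> ->; rewrite cards1 subn1.
have n0 : n%:R != 0 :> R by rewrite pnatr_eq0; case: n i {bn} => [[]|].
have C0 : 'C(n, b)%:R != 0 :> R by rewrite pnatr_eq0 -lt0n bin_gt0.
have := congr1 (fun k : nat => k%:R : R) (mul_bin_down n b).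
rewrite /= !natrM natrB // => H.
apply: (mulfI n0); rewrite mulrA H.
by field; rewrite n0 C0.
Qed.

(** The probability (n - b)(n - b - 1) / (n (n - 1)) is written as the one-point value minus a
    correction; the correction is what survives in the variance. *)
Lemma batch_law_avoid2 (R : realType) n b (i j : 'I_n) :
  (2 <= n)%N -> (b <= n)%N -> i != j ->
  \sum_(S : {set 'I_n}) batch_law R b S * ((i \notin S) && (j \notin S))%:R
  = 1 - b%:R / n%:R - (n%:R - b%:R) * b%:R / (n%:R * (n%:R - 1)).
Proof.
move=> n2 bn ij; have := @batch_law_avoid R n b [set i; j].
under eq_bigr => S _ do rewrite finset.disjoints_subset finset.setCU finset.subsetI
  -!finset.disjoints_subset !(disjoint_sym S) !disjoints1.
move=> ->; rewrite cards2 ij.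
have n0 : n%:R != 0 :> R by rewrite pnatr_eq0 -lt0n; apply: leq_trans n2.
have n1E : n.-1%:R = n%:R - 1 :> R by rewrite -subn1 natrB// ltnW.
have n10 : n%:R - 1 != 0 :> R.
  by rewrite -n1E pnatr_eq0 -lt0n -ltnS prednK// ltnW.
have C0 : 'C(n, b)%:R != 0 :> R by rewrite pnatr_eq0 -lt0n bin_gt0.
have := congr1 (fun k : nat => k%:R : R) (mul_bin_down n b).
rewrite /= !natrM (natrB _ bn) => H1.
have H2 : (n%:R - 1) * 'C(n - 2, b)%:R = (n%:R - 1 - b%:R) * 'C(n.-1, b)%:R :> R.
  rewrite -n1E subn2 -natrM mul_bin_down natrM.
  (* For [b = n] the subtraction in [nat] truncates, but ['C(n.-1, b)] vanishes too. *)
  have [bn1|] := leqP b n.-1; first by rewrite natrB.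
  by move=> /bin_small ->; rewrite !mulr0.
have C1E : 'C(n.-1, b)%:R = (n%:R - b%:R) * 'C(n, b)%:R / n%:R :> R.
  by apply: (mulfI n0); rewrite H1; field.
have -> : 'C(n - 2, b)%:R =
    (n%:R - 1 - b%:R) * ((n%:R - b%:R) * 'C(n, b)%:R / n%:R) / (n%:R - 1) :> R.
  by apply: (mulfI n10); rewrite H2 C1E; field; rewrite n0 n10.
by field; rewrite n0 n10 C0.
Qed.

Local Open Scope classical_set_scope.

(** * The Euclidean inner product *)

Definition dot {R : realType} {p} (u v : 'cV[R]_p) : R := (u^T *m v) 0 0.

Lemma dotE {R : realType} {p} (u v : 'cV[R]_p) : dot u v = \sum_j u j 0 * v j 0.
Proof. by rewrite /dot mxE; apply: eq_bigr => j _; rewrite mxE. Qed.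

Lemma dotC {R : realType} {p} (u v : 'cV[R]_p) : dot u v = dot v u.
Proof. by rewrite !dotE; apply: eq_bigr => j _; rewrite mulrC. Qed.

Lemma dotDl {R : realType} {p} (u v x : 'cV[R]_p) :
  dot (u + v) x = dot u x + dot v x.
Proof. by rewrite /dot linearD mulmxDl mxE. Qed.

Lemma dotZl {R : realType} {p} k (u x : 'cV[R]_p) : dot (k *: u) x = k * dot u x.
Proof. by rewrite /dot linearZ -scalemxAl mxE. Qed.

Lemma dotNl {R : realType} {p} (u x : 'cV[R]_p) : dot (- u) x = - dot u x.
Proof. by rewrite -scaleN1r dotZl mulN1r. Qed.

Lemma dotDr {R : realType} {p} (u v x : 'cV[R]_p) :
  dot x (u + v) = dot x u + dot x v.
Proof. by rewrite ![dot x _]dotC dotDl. Qed.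

Lemma dotZr {R : realType} {p} k (u x : 'cV[R]_p) : dot x (k *: u) = k * dot x u.
Proof. by rewrite ![dot x _]dotC dotZl. Qed.

Lemma dotNr {R : realType} {p} (u x : 'cV[R]_p) : dot x (- u) = - dot x u.
Proof. by rewrite ![dot x _]dotC dotNl. Qed.

Lemma dot0l {R : realType} {p} (x : 'cV[R]_p) : dot 0 x = 0.
Proof. by rewrite -(scale0r 0) dotZl mul0r. Qed.

Lemma dot0r {R : realType} {p} (x : 'cV[R]_p) : dot x 0 = 0.
Proof. by rewrite dotC dot0l. Qed.

Definition dotLR {R : realType} {p} :=
  (@dotDl R p, @dotDr R p, @dotNl R p, @dotNr R p, @dotZl R p, @dotZr R p).

Lemma dot_mulmx_sym {R : realType} {p} (A : 'M[R]_p) (u v : 'cV[R]_p) :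
  A^T = A -> dot (A *m u) v = dot u (A *m v).
Proof. by move=> sA; rewrite /dot trmx_mul sA mulmxA. Qed.

Lemma dot_ge0 {R : realType} {p} (u : 'cV[R]_p) : 0 <= dot u u.
Proof. by rewrite dotE sumr_ge0 // => j _; rewrite -expr2 sqr_ge0. Qed.

Lemma dot_eq0 {R : realType} {p} (u : 'cV[R]_p) : (dot u u == 0) = (u == 0).
Proof.
apply/eqP/eqP => [|->]; last exact: dot0l.
rewrite dotE => /psumr_eq0P H; apply/colP => j; rewrite mxE.
have /eqP := H (fun j _ => sqr_ge0 (u j 0)) j isT.
by rewrite sqrf_eq0 => /eqP.
Qed.

Lemma dot_gt0 {R : realType} {p} (u : 'cV[R]_p) : u != 0 -> 0 < dot u u.
Proof. by move=> u0; rewrite lt_neqAle eq_sym dot_eq0 u0 dot_ge0. Qed.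

Lemma l2norm_sqr {R : realType} {p} (u : 'cV[R]_p) : l2norm u ^+ 2 = dot u u.
Proof.
have -> : dot u u = \sum_j u j 0 ^+ 2 by rewrite dotE.
by rewrite sqr_sqrtr // sumr_ge0 // => j _; rewrite sqr_ge0.
Qed.

Lemma dot_cauchy {R : realType} {p} (u v : 'cV[R]_p) :
  dot u v ^+ 2 <= dot u u * dot v v.
Proof.
have [->|v0] := eqVneq v 0; first by rewrite !dot0r expr0n mulr0.
have := dot_ge0 (dot v v *: u - dot u v *: v).
rewrite !dotLR (dotC v u); move: (dot_gt0 v0) => d0 H.
rewrite -subr_ge0 -(pmulr_rge0 _ d0); apply: le_trans H _; lra.
Qed.

(** * Quadratic-form bounds and extreme eigenvalues *)

(** Cauchy-Schwarz on each row: [K] is 1 plus the squared Frobenius norm, the 1 making it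
    positive. *)
Lemma mulmx_dot_bound {R : realType} {p} (M : 'M[R]_p) :
  exists2 K, 0 < K & forall x, dot (M *m x) (M *m x) <= K * dot x x.
Proof.
exists (1 + \sum_j dot (row j M)^T (row j M)^T).
  by rewrite ltr_pwDl// sumr_ge0 // => j _; apply: dot_ge0.
move=> x; rewrite mulrDl mul1r ler_wpDl ?dot_ge0// dotE mulr_suml ler_sum// => j _.
suff -> : (M *m x) j 0 = dot (row j M)^T x by rewrite -expr2 dot_cauchy.
by rewrite dotE mxE; apply: eq_bigr => k _; rewrite !mxE.
Qed.

(** In operator terms, 0 <= A <= K implies A^2 <= K A. Positivity of [A] at K x - A x gives K^2 <x,
    Ax> - 2 K |Ax|^2 + <Ax, A Ax> >= 0, and the last term is at most K |Ax|^2. *)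
Lemma psd_dot_sqr_le {R : realType} {p} (A : 'M[R]_p) (K : R) :
  sym_psd A -> 0 < K -> (forall x, dot x (A *m x) <= K * dot x x) ->
  forall x, dot (A *m x) (A *m x) <= K * dot x (A *m x).
Proof.
move=> [sA pA] K0 AK x.
have := pA (K *: x - A *m x); rewrite -mulmxA -/(dot _ _) mulmxBr -scalemxAr.
move: (AK (A *m x)); rewrite !dotLR -(dot_mulmx_sym x (A *m x)) // => H1 H2.
rewrite -subr_ge0 -(pmulr_rge0 _ K0); lra.
Qed.

(* Bottom of the spectrum without the spectral theorem: let [m] be the largest
   real with [A - m >= 0]. If [A - m] were invertible it would be coercive,
   since [|x|^2 <= C |(A - m) x|^2 <= C' <x, (A - m) x>], and [m] could be
   increased. *)
Lemma rayleigh_min {R : realType} {p} (A : 'M[R]_p) : (0 < p)%N -> A^T = A ->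
  exists2 m, eigenvalue A m & forall x, m * dot x x <= dot x (A *m x).
Proof.
move=> p0 sA.
pose S := [set s : R | forall x, s * dot x x <= dot x (A *m x)].
have [K K0 AK] := mulmx_dot_bound A.
(* Expanding |x + Ax|^2 >= 0 bounds <x, Ax> from below, so [S] is nonempty. *)
have S0 : S (- (1 + K)).
  move=> x; have := dot_ge0 (x + A *m x); have := AK x.
  have := dot_ge0 x; rewrite !dotLR (dotC (A *m x)); nra.
pose e : 'cV[R]_p := const_mx 1.
have e0 : e != 0.
  by apply/eqP => /colP/(_ (Ordinal p0)); rewrite !mxE => /eqP; rewrite oner_eq0.
have Sub x : x != 0 -> ubound S (dot x (A *m x) / dot x x).
  by move=> x0 s Ss; rewrite ler_pdivlMr ?dot_gt0.
have hub : has_ubound S by exists (dot e (A *m e) / dot e e); exact: Sub.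
have Sm : S (sup S).
  move=> x; have [->|x0] := eqVneq x 0; first by rewrite !dot0l mulr0.
  by rewrite -ler_pdivlMr ?dot_gt0// ge_sup//; [exists (- (1 + K)) | exact: Sub].
exists (sup S); last exact: Sm.
set m := sup S in Sm *.
pose M := A - m%:M.
(* A singular [M] has a nonzero kernel, which is the eigenspace at [m]; the invertible case must
   contradict the maximality of [m]. *)
have [Munit|] := boolP (M \in unitmx); last first.
  by rewrite -row_free_unit -kermx_eq0.
have sM : M^T = M by rewrite linearB /= sA tr_scalar_mx.
have Mx x : M *m x = A *m x - m *: x by rewrite mulmxBl mul_scalar_mx.
have pM : sym_psd M.
  by split=> // x; rewrite -mulmxA -/(dot _ _) Mx !dotLR subr_ge0.
have [K1 K10 MK1] := mulmx_dot_bound M.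
have [K2 K20 MK2] := mulmx_dot_bound (invmx M).
have MK1' x : dot x (M *m x) <= (1 + K1) * dot x x.
  have := dot_ge0 (x - M *m x); have := MK1 x; have := dot_ge0 (M *m x).
  have := dot_ge0 x; rewrite !dotLR (dotC (M *m x) x); nra.
have K1' : 0 < 1 + K1 by lra.
have := psd_dot_sqr_le pM K1' MK1' => Msq.
have Kp : 0 < K2 * (1 + K1) by rewrite mulr_gt0.
suff : S (m + (K2 * (1 + K1))^-1).
  by move=> /(ub_le_sup hub); rewrite gerDl leNgt invr_gt0 Kp.
move=> x; rewrite mulrDl -lerBrDl.
have -> : dot x (A *m x) - m * dot x x = dot x (M *m x) by rewrite Mx !dotLR.
rewrite mulrC ler_pdivrMr// mulrC.
have := MK2 (M *m x); rewrite mulmxA mulVmx// mul1mx => /le_trans; apply.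
by rewrite -mulrA ler_pM2l.
Qed.

(** [eigenvalue] concerns row vectors; by symmetry the transpose is a column eigenvector. *)
Lemma eigenvalue_dot_col {R : realType} {p} (A : 'M[R]_p) (l : R) :
  A^T = A -> eigenvalue A l -> exists2 x : 'cV_p, x != 0 & A *m x = l *: x.
Proof.
move=> sA /eigenvalueP[v vA v0]; exists v^T.
  by rewrite -(trmx0 R 1 p) (inj_eq trmx_inj).
by rewrite -[in LHS]sA -trmx_mul vA linearZ.
Qed.

(** The Rayleigh minimum [m] is itself an eigenvalue, so [inf] is at most [m] once the spectrum is
    bounded below; [m] is such a bound, by testing on eigenvectors. *)
Lemma lambda_min_le {R : realType} {p} (A : 'M[R]_p) : A^T = A ->
  forall x, lambda_min A * dot x x <= dot x (A *m x).
Proof.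
move=> sA x; have [p0|p0] := posnP p.
  by subst p; rewrite !dotE !big_ord0 mulr0.
have [m Am mA] := rayleigh_min p0 sA.
apply: le_trans (mA x); rewrite ler_wpM2r ?dot_ge0// ge_inf//.
exists m => l /= /(eigenvalue_dot_col sA)[y y0 Ay].
by have := mA y; rewrite Ay dotZr ler_pM2r ?dot_gt0.
Qed.

(** This is the bottom of the spectrum of [- A], with signs reversed. *)
Lemma lambda_max_ge {R : realType} {p} (A : 'M[R]_p) : A^T = A ->
  forall x, dot x (A *m x) <= lambda_max A * dot x x.
Proof.
move=> sA x; have [p0|p0] := posnP p.
  by subst p; rewrite !dotE !big_ord0 mulr0.
have sNA : (- A)^T = - A by rewrite linearN /= sA.
have [m Am mA] := rayleigh_min p0 sNA.
have Am' y : dot y (A *m y) <= - m * dot y y.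
  by have := mA y; rewrite mulNmx dotNr mulNr lerNr.
apply: le_trans (Am' x) _; rewrite ler_wpM2r ?dot_ge0// ub_le_sup//=.
  exists (- m) => l /= /(eigenvalue_dot_col sA)[y y0 Ay].
  by have := Am' y; rewrite Ay dotZr ler_pM2r ?dot_gt0.
have /eigenvalueP[v vA v0] := Am; apply/eigenvalueP; exists v => //.
by rewrite scaleNr -vA mulmxN opprK.
Qed.

(** * Gradient of a quadratic *)

Lemma quadraticE {R : realType} {p} (A : 'M[R]_p) (c w : 'cV[R]_p) :
  quadratic A c w = 2^-1 * dot w (A *m w) - dot c w.
Proof. by rewrite /quadratic /dot mulmxA. Qed.

Lemma gradient_quadratic {R : realType} {p} (A : 'M[R]_p) (c w : 'cV[R]_p) :
  A^T = A -> gradient (quadratic A c) w = A *m w - c.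
Proof.
move=> sA; apply/colP => j; rewrite mxE; set v := delta_mx j 0.
have -> : (A *m w - c) j 0 = dot v (A *m w - c).
  rewrite dotE (bigD1 j)//= big1 ?addr0; last first.
    by move=> i /negbTE ij; rewrite /v mxE ij mul0r.
  by rewrite [v j 0]mxE !eqxx mul1r.
set d := dot v _; apply: cvg_lim => //.
(* For nonzero [h] the difference quotient along [v] equals [g h], which is affine in [h] with value
   [d] at 0. *)
pose g h := d + h * (2^-1 * dot v (A *m v)).
have cg : g @ (0 : R)^' --> d.
  have -> : d = g 0 by rewrite /g mul0r addr0.
  apply: cvg_within_filter; apply: cvgD; first exact: cvg_cst.
  by apply: cvgMl; exact: cvg_id.
apply: cvg_trans cg.
apply: near_eq_cvg; near=> h.
have h0 : h != 0 by near: h; exact: nbhs_dnbhs_neq.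
rewrite /= !quadraticE mulmxDr -scalemxAr !dotLR -(dot_mulmx_sym w v) // (dotC (A *m w)).
rewrite /g /d !dotLR (dotC c v) /GRing.scale /=.
by field.
Unshelve. all: by end_near. Qed.

(** * The energy of the mean iteration *)

(* On an eigenvector of [A] with eigenvalue [l] the mean step has the complex
   conjugate characteristic roots [r], [r^*] with [r + r^* = 1 + b - a l] and
   [r r^* = b], and this form is [|x - r y|^2]; hence [energy_step]. *)
Definition energy {R : realType} {p} (A : 'M[R]_p) (a b : R)
    (x y : 'cV[R]_p) : R :=
  dot x x - dot x ((1 + b) *: y - a *: (A *m y)) + b * dot y y.

Lemma energy_step {R : realType} {p} (A : 'M[R]_p) (a b : R) (x y : 'cV[R]_p) :
  A^T = A ->
  energy A a b (x - a *: (A *m x) + b *: (x - y)) x = b * energy A a b x y.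
Proof.
move=> sA; rewrite /energy !dotLR !(dot_mulmx_sym _ _ sA).
rewrite (dotC y (A *m x)) !(dot_mulmx_sym _ _ sA) (dotC y x).
ring.
Qed.

(** Isolates a noise term [u]: the part linear in [u] averages out over an unbiased batch, and |u|^2
    stays. *)
Lemma energyB {R : realType} {p} (A : 'M[R]_p) (a b : R) (x y u : 'cV[R]_p) :
  energy A a b (x - u) y = energy A a b x y + dot u u
    - dot u (2 *: x - ((1 + b) *: y - a *: (A *m y))).
Proof. by rewrite /energy !dotLR (dotC x u); ring. Qed.

(** Gives the starting energy, since w_{-1} = w_0. *)
Lemma energy_diag {R : realType} {p} (A : 'M[R]_p) (a b : R) (x : 'cV[R]_p) :
  energy A a b x x = a * dot x (A *m x).
Proof. by rewrite /energy !dotLR; ring. Qed.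

(** With K = (1 + b) I - a A, completing the square in [y] gives 4 b V = |2 b y - K x|^2 + 4 b |x|^2
    - |K x|^2. The first square is dropped; the rest is bounded below using a^2 A^2 <= a A and q^2
    <= a A. *)
Lemma energy_coercive {R : realType} {p} (A : 'M[R]_p) (a q : R) :
  sym_psd A -> 0 < a -> 0 < q -> q <= 1 ->
  (forall x, q ^+ 2 * dot x x <= a * dot x (A *m x)) ->
  (forall x, a * dot x (A *m x) <= dot x x) ->
  forall x y, 11 / 64 * q ^+ 2 * dot x x
              <= energy A a ((1 - 2^-1 * q) ^+ 2) x y.
Proof.
move=> pA a0 q0 q1 lo hi x y; have [sA _] := pA.
set b : R := (1 - 2^-1 * q) ^+ 2.
have b0 : 0 < b by rewrite /b; nra.
have Asq : a ^+ 2 * dot (A *m x) (A *m x) <= a * dot x (A *m x).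
  rewrite expr2 -mulrA ler_pM2l// -ler_pdivlMl//.
  by apply: psd_dot_sqr_le; rewrite ?invr_gt0// => z; rewrite ler_pdivlMl.
have := dot_ge0 (2 * b *: y - ((1 + b) *: x - a *: (A *m x))).
have -> : energy A a b x y = dot x x - dot y ((1 + b) *: x - a *: (A *m x)) + b * dot y y.
  by rewrite /energy !dotLR (dotC y x) (dotC y (A *m x)) (dot_mulmx_sym _ _ sA).
rewrite !dotLR (dotC y x) (dotC (A *m x) x) (dotC (A *m x) y).
have := lo x; have := dot_ge0 x.
move: Asq.
set xx := dot x x; set xA := dot x (A *m x); set AA := dot (A *m x) _.
set yA := dot y (A *m x); set xy := dot x y; set yy := dot y y.
move=> Asq xx0 lox H.
rewrite -(ler_pM2l b0) -(ler_pM2l (_ : 0 < 4)) //.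
have b1 : b <= 1 by rewrite /b; nra.
set E := (X in _ <= 4 * (b * X)).
have E1 : 4 * (b * E) >= 4 * b * xx - ((1 + b) ^+ 2 * xx - 2 * (1 + b) * a * xA
    + a ^+ 2 * AA) by rewrite /E; nra.
apply: le_trans E1.
have E2 : 4 * (b * (11 / 64 * q ^+ 2 * xx)) <= 11 / 16 * q ^+ 2 * xx.
  have : 0 <= q ^+ 2 * xx * (1 - b) by rewrite mulr_ge0 ?subr_ge0// mulr_ge0// sqr_ge0.
  lra.
apply: le_trans E2 _.
have E3 : (1 + 2 * b) * (a * xA - q ^+ 2 * xx) >= 0.
  by rewrite mulr_ge0 ?subr_ge0//; lra.
(* Since 1 - b = q (1 - q/4), the coefficient of [xx] on the right is q^2 (2 - 3q/2 + 7q^2/16), at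
   least (15/16) q^2 for 0 <= q <= 1. *)
suff : 11 / 16 * q ^+ 2 * xx <=
    (4 * b - (1 + b) ^+ 2 + (1 + 2 * b) * q ^+ 2) * xx by nra.
rewrite ler_wpM2r// /b.
nra.
Qed.

(** * Mean and variance under sampling without replacement *)

Lemma dot_suml {R : realType} {p} (I : finType) (Q : pred I)
    (F : I -> 'cV[R]_p) x :
  dot (\sum_(i | Q i) F i) x = \sum_(i | Q i) dot (F i) x.
Proof. by apply: (big_morph (fun u => dot u x)) => [u v|]; rewrite ?dotDl ?dot0l. Qed.

Lemma dot_sumr {R : realType} {p} (I : finType) (Q : pred I)
    (F : I -> 'cV[R]_p) x :
  dot x (\sum_(i | Q i) F i) = \sum_(i | Q i) dot x (F i).
Proof. by rewrite dotC dot_suml; apply: eq_bigr => i _; rewrite dotC. Qed.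

Definition batch_mean {R : realType} {p n} (b : nat) (v : 'I_n -> 'cV[R]_p)
    (S : {set 'I_n}) : 'cV[R]_p := b%:R^-1 *: \sum_(i in S) v i.

Definition mean {R : realType} {p n} (v : 'I_n -> 'cV[R]_p) : 'cV[R]_p :=
  n%:R^-1 *: \sum_(i < n) v i.

Lemma sum_centered {R : realType} {p n} (v : 'I_n -> 'cV[R]_p) : (0 < n)%N ->
  \sum_(i < n) (v i - mean v) = 0.
Proof.
move=> n0; rewrite sumrB sumr_const card_ord -scaler_nat /mean scalerA divff ?scale1r ?subrr//.
by rewrite pnatr_eq0 -lt0n.
Qed.

(* The centred vectors sum to 0, so the sample may be traded for its
   complement, whose inclusion probabilities are plain subset counts. *)
Lemma batch_mean_centered {R : realType} {p n} (b : nat) (v : 'I_n -> 'cV[R]_p)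
    (S : {set 'I_n}) : (0 < b <= n)%N -> #|S| = b ->
  batch_mean b v S - mean v
  = - b%:R^-1 *: \sum_(i < n) (i \notin S)%:R *: (v i - mean v).
Proof.
move=> /andP[b0 bn] Sb.
have := sum_centered v (leq_trans b0 bn).
rewrite (bigID (mem S)) /= => /eqP; rewrite addr_eq0 => /eqP SE.
have -> : \sum_(i < n) (i \notin S)%:R *: (v i - mean v)
    = \sum_(i | i \notin S) (v i - mean v).
  rewrite [RHS]big_mkcond; apply: eq_bigr => i _.
  by case: (i \notin S); rewrite ?scale1r ?scale0r.
rewrite scaleNr -scalerN -SE sumrB sumr_const Sb scalerBr -[mean v *+ b]scaler_nat scalerA.
by rewrite mulVf ?scale1r// pnatr_eq0 -lt0n.
Qed.

(** Every index is missed with the same probability, so the average is a multiple of the zero sum of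
    the centred vectors. *)
Lemma batch_mean_unbiased {R : realType} {p n} (b : nat) (v : 'I_n -> 'cV[R]_p)
    (z : 'cV[R]_p) : (0 < b <= n)%N ->
  \sum_(S : {set 'I_n}) batch_law R b S * dot (batch_mean b v S - mean v) z = 0.
Proof.
move=> bn; have [b0 b_n] := andP bn.
transitivity (\sum_(i < n) (- b%:R^-1 * dot (v i - mean v) z *
    \sum_(S : {set 'I_n}) batch_law R b S * (i \notin S)%:R)).
  under [RHS]eq_bigr do rewrite mulr_sumr.
  rewrite exchange_big; apply: eq_bigr => S _ /=.
  have [Sb|Sb] := eqVneq #|S| b; last first.
    rewrite /batch_law (negbTE Sb) mul0r.
    by rewrite big1// => i _; rewrite mul0r mulr0.
  rewrite batch_mean_centered// dotZl dot_suml !mulr_sumr.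
  by apply: eq_bigr => i _; rewrite dotZl; ring.
under eq_bigr do rewrite batch_law_avoid1//.
by rewrite -mulr_suml -mulr_sumr -dot_suml sum_centered ?(leq_trans b0)// dot0l mulr0 mul0r.
Qed.

(** The square expands into pairs of missed indices, and a pair is missed with probability (c1 - c2)
    + c2 [i = j]. The constant part multiplies the zero sum of the centred vectors; the diagonal
    leaves the factor c2 / b^2. *)
Lemma batch_mean_variance {R : realType} {p n} (b : nat) (v : 'I_n -> 'cV[R]_p) :
  (2 <= n)%N -> (0 < b <= n)%N ->
  \sum_(S : {set 'I_n}) batch_law R b S *
    dot (batch_mean b v S - mean v) (batch_mean b v S - mean v)
  = (n%:R - b%:R) / ((n%:R - 1) * b%:R) *
    (n%:R^-1 * \sum_(i < n) dot (v i - mean v) (v i - mean v)).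
Proof.
move=> n2 bn; have [b0 b_n] := andP bn.
set x := fun i => v i - mean v.
set c1 : R := 1 - b%:R / n%:R.
set c2 : R := (n%:R - b%:R) * b%:R / (n%:R * (n%:R - 1)).
transitivity (\sum_(i < n) \sum_(j < n) (b%:R^-1 ^+ 2 * dot (x i) (x j) *
    \sum_(S : {set 'I_n}) batch_law R b S * ((i \notin S) && (j \notin S))%:R)).
  under [RHS]eq_bigr do under eq_bigr do rewrite mulr_sumr.
  under [RHS]eq_bigr do rewrite exchange_big.
  rewrite exchange_big; apply: eq_bigr => S _ /=.
  have [Sb|Sb] := eqVneq #|S| b; last first.
    rewrite /batch_law (negbTE Sb) mul0r.
    by rewrite big1// => i _; rewrite big1// => j _; rewrite mul0r mulr0.
  rewrite batch_mean_centered// dotZl dotZr dot_suml !mulr_sumr.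
  apply: eq_bigr => i _; rewrite dot_sumr !mulr_sumr; apply: eq_bigr => j _.
  by rewrite dotZl dotZr -mulnb natrM /x; ring.
have E i j : \sum_(S : {set 'I_n}) batch_law R b S * ((i \notin S) && (j \notin S))%:R
    = (c1 - c2) + c2 * (i == j)%:R.
  have [->|ij] := eqVneq i j; last by rewrite batch_law_avoid2// mulr0 addr0.
  under eq_bigr do rewrite andbb.
  by rewrite batch_law_avoid1// mulr1 subrK.
under eq_bigr do under eq_bigr do rewrite E mulrDr.
under eq_bigr do rewrite big_split.
rewrite big_split /= [X in X + _]big1 ?add0r; last first.
  by move=> i _; rewrite -mulr_suml -mulr_sumr -dot_sumr sum_centered
    ?(leq_trans b0)// dot0r mulr0 mul0r.
rewrite !mulr_sumr; apply: eq_bigr => i _.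
rewrite (bigD1 i)//= eqxx big1 ?addr0 ?mulr1; last first.
  by move=> j /negbTE ji; rewrite eq_sym ji !mulr0.
have b0' : b%:R != 0 :> R by rewrite pnatr_eq0 -lt0n.
have n0 : n%:R != 0 :> R by rewrite pnatr_eq0 -lt0n ltnW.
have n10 : n%:R - 1 != 0 :> R by rewrite subr_eq0 pnatr_eq1 gtn_eqF.
by rewrite /c2; field; rewrite n10 n0 b0'.
Qed.

(** The variance over the indices is the second moment minus |mean v|^2. *)
Lemma batch_mean_variance_le {R : realType} {p n} (b : nat) (v : 'I_n -> 'cV[R]_p) :
  (2 <= n)%N -> (0 < b <= n)%N ->
  \sum_(S : {set 'I_n}) batch_law R b S *
    dot (batch_mean b v S - mean v) (batch_mean b v S - mean v)
  <= (n%:R - b%:R) / ((n%:R - 1) * b%:R) *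
    (n%:R^-1 * \sum_(i < n) dot (v i) (v i)).
Proof.
move=> n2 bn; have [b0 b_n] := andP bn; rewrite batch_mean_variance//.
rewrite ler_wpM2l//.
  by rewrite divr_ge0 ?mulr_ge0 ?subr_ge0 ?ler_nat ?ler1n// ltnW.
rewrite ler_wpM2l ?invr_ge0 ?ler0n//.
have := sum_centered v (leq_trans b0 b_n).
move: (mean v) => m vm.
have -> : \sum_(i < n) dot (v i) (v i)
    = \sum_(i < n) dot (v i - m) (v i - m) + n%:R * dot m m.
  transitivity (\sum_(i < n) (dot (v i - m) (v i - m) + (2 * dot (v i - m) m + dot m m))).
    by apply: eq_bigr => i _; rewrite !dotLR (dotC m); ring.
  rewrite big_split /= big_split /=; congr (_ + _).
  by rewrite -mulr_sumr -dot_suml vm dot0l mulr0 add0r sumr_const card_ord mulr_natl.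
by rewrite lerDl mulr_ge0 ?ler0n ?dot_ge0.
Qed.

(** * Expectations over finite batch histories *)

(** The possible histories of [k] draws. New letters are appended on the right, so summing over the
    last one conditions on the past. *)
Fixpoint words (V : finType) (k : nat) : seq (seq V) :=
  if k is k'.+1 then [seq rcons s v | s <- words V k', v <- enum V] else [:: [::]].

Lemma size_words (V : finType) k (s : seq V) : s \in words V k -> size s = k.
Proof.
elim: k s => [s|k IH s]; first by rewrite inE => /eqP ->.
by move=> /allpairsP[[s' v] /= [/IH <- _ ->]]; rewrite size_rcons.
Qed.

Lemma sum_wordsS (R : realType) (V : finType) k (F : seq V -> R) :
  \sum_(s <- words V k.+1) F s = \sum_(s <- words V k) \sum_v F (rcons s v).
Proof. by rewrite big_allpairs_dep /=; under eq_bigr do rewrite big_enum. Qed.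

(** Each history is enumerated exactly once, so a function of the history is a finite combination of
    indicators. *)
Lemma sum_words_pick (R : realType) (V : finType) (x : nat -> V)
    (F : seq V -> R) k :
  \sum_(s <- words V k) F s * (mkseq x k == s)%:R = F (mkseq x k).
Proof.
elim: k F => [|k IH] F; first by rewrite big_seq1 eqxx mulr1.
rewrite sum_wordsS mkseqS -(IH (fun s => F (rcons s (x k)))); apply: eq_bigr => s _.
under eq_bigr do rewrite eqseq_rcons.
rewrite (bigD1 (x k))//= eqxx andbT big1 ?addr0; last first.
  by move=> v /negbTE vx; rewrite (eq_sym (x k)) vx andbF mulr0.
by [].
Qed.

(** The integrand is the simple function with value [F s] on the event [A s] that the history is
    [s]; independence makes the probability of [A s] a product. *)
Lemma expectation_words (d : measure_display) (Om : measurableType d)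
    (R : realType) (P : probability Om R) (V : finType) (X : nat -> Om -> V)
    (u : V -> R) (v0 : V) (F : seq V -> R) (k : nat) :
  (forall j, discrete_rv (X j)) -> mutually_independent P X ->
  (forall j v, P (X j @^-1` [set v]) = (u v)%:E) -> (forall s, 0 <= F s) ->
  ('E_P[(fun om => F (mkseq (X^~ om) k))%R]
   = (\sum_(s <- words V k) F s * \prod_(v <- s) u v)%R%:E)%E.
Proof.
move=> mX iX lX F0.
(* [v0] is only the default of [nth]: words have length [k] and [j] stays below [k]. *)
pose A s := \bigcap_(j in [set` iota 0 k]) (X j @^-1` [set nth v0 s j]).
have mA s : measurable (A s) by apply: bigcap_measurableType => j _; exact: mX.
have AE s om : s \in words V k -> \1_(A s) om = (mkseq (X^~ om) k == s)%:R :> R.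
  move=> /size_words sk; rewrite indicE; congr ((nat_of_bool _)%:R); apply/idP/eqP.
    rewrite inE => As; apply: (@eq_from_nth _ v0); first by rewrite size_mkseq.
    move=> j; rewrite size_mkseq => jk; rewrite nth_mkseq//.
    by apply: (As j); rewrite /= mem_iota.
  by move=> <-; rewrite inE => j /=; rewrite mem_iota => jk; rewrite nth_mkseq.
have PA s : s \in words V k -> P (A s) = (\prod_(v <- s) u v)%:E.
  move=> /size_words sk; rewrite (iX _ (fun j => [set nth v0 s j])) ?iota_uniq//.
  transitivity (\prod_(j <- iota 0 k) (u (nth v0 s j))%:E)%E.
    by apply: eq_bigr => j _; rewrite lX.
  by rewrite prodEFin -[in RHS](mkseq_nth v0 s) big_map sk.
rewrite unlock.
transitivity (\int[P]_om (\sum_(s <- words V k) (F s)%:E * (\1_(A s) om)%:E)%E)%E.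
  apply: eq_integral => om _; rewrite -sum_words_pick -sumEFin.
  by rewrite big_seq [RHS]big_seq; apply: eq_bigr => s sk; rewrite EFinM AE.
rewrite ge0_integral_sum//; last 2 first.
- by move=> s; apply: emeasurable_funM; [exact: measurable_cst|
    by apply/measurable_EFinP; exact: measurable_indic].
- by move=> s om _; rewrite mule_ge0 ?lee_fin.
rewrite -sumEFin big_seq [RHS]big_seq; apply: eq_bigr => s sk.
rewrite ge0_integralZl_EFin//; last first.
  by apply/measurable_EFinP; exact: measurable_indic.
by rewrite EFinM -(PA s sk) integral_indic// setIT.
Qed.

Lemma sum_words_prod1 (R : realType) (V : finType) (u : V -> R) k :
  \sum_v u v = 1 -> \sum_(s <- words V k) \prod_(v <- s) u v = 1.
Proof.
move=> u1; elim: k => [|k IH]; first by rewrite big_seq1 big_nil.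
rewrite sum_wordsS -[RHS]IH; apply: eq_bigr => s _.
under [LHS]eq_bigr do rewrite big_rcons.
by rewrite -mulr_sumr u1 mulr1.
Qed.

(** Jensen for the square, from a nonnegative variance about the mean [m]; it passes from second
    moments to the expected norm. *)
Lemma sum_words_sqr (R : realType) (V : finType) (u : V -> R) (F : seq V -> R) k :
  (forall v, 0 <= u v) -> \sum_v u v = 1 ->
  (\sum_(s <- words V k) F s * \prod_(v <- s) u v) ^+ 2 <=
  \sum_(s <- words V k) F s ^+ 2 * \prod_(v <- s) u v.
Proof.
move=> u0 u1; set m := \sum_(s <- _) _.
have : 0 <= \sum_(s <- words V k) (F s - m) ^+ 2 * \prod_(v <- s) u v.
  by apply: sumr_ge0 => s _; rewrite mulr_ge0 ?sqr_ge0 ?prodr_ge0.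
set X := \sum_(s <- _) F _ ^+ 2 * _.
suff -> : \sum_(s <- words V k) (F s - m) ^+ 2 * \prod_(v <- s) u v
  = X - 2 * m * m + m ^+ 2 * \sum_(s <- words V k) \prod_(v <- s) u v.
  by rewrite sum_words_prod1//; lra.
rewrite {3}/m /X mulr_sumr mulr_sumr -sumrB -big_split /=.
by apply: eq_bigr => s _; ring.
Qed.

(** * Contraction of the expected energy *)

Lemma heavy_ball_state_ext (R : realType) p (g h : nat -> 'cV[R]_p -> 'cV[R]_p)
    (alpha beta : R) (w0 : 'cV[R]_p) k :
  (forall j, (j < k)%N -> g j = h j) ->
  heavy_ball_state g alpha beta w0 k = heavy_ball_state h alpha beta w0 k.
Proof.
elim: k => // k IH gh; rewrite /= (IH (fun j jk => gh j (ltnW jk))).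
by case: heavy_ball_state => x y; rewrite gh.
Qed.

(** By induction on [k]: with the first [k] letters fixed the state is fixed, so the one-step bound
    applies to the sum over the last letter. *)
Lemma heavy_ball_supermartingale (R : realType) p (V : finType) (v0 : V)
    (u : V -> R) (g : V -> 'cV[R]_p -> 'cV[R]_p) (E : 'cV[R]_p -> 'cV[R]_p -> R)
    (alpha beta rho : R) (w0 : 'cV[R]_p) :
  (forall v, 0 <= u v) -> 0 <= rho ->
  (forall x y, \sum_v u v * E (x - alpha *: g v x + beta *: (x - y)) x
               <= rho * E x y) ->
  forall k,
  let st s := heavy_ball_state (fun j => g (nth v0 s j)) alpha beta w0 k in
  \sum_(s <- words V k) E (st s).1 (st s).2 * \prod_(v <- s) u v
  <= rho ^+ k * E w0 w0.
Proof.
move=> u0 r0 step; elim=> [|k IH] /=.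
  by rewrite big_seq1 big_nil mulr1 expr0 mul1r.
rewrite sum_wordsS exprS -mulrA; apply: le_trans (ler_wpM2l r0 IH).
rewrite mulr_sumr big_seq [leRHS]big_seq; apply: ler_sum => s /size_words sk.
have stE v : heavy_ball_state (fun j => g (nth v0 (rcons s v) j)) alpha beta w0 k
    = heavy_ball_state (fun j => g (nth v0 s j)) alpha beta w0 k.
  by apply: heavy_ball_state_ext => j jk; rewrite nth_rcons sk jk.
under [leLHS]eq_bigr do rewrite stE big_rcons nth_rcons sk ltnn eqxx.
case: heavy_ball_state => x y /=.
rewrite mulrA; apply: le_trans (ler_wpM2r _ (step x y)); last exact: prodr_ge0.
by rewrite mulr_suml le_eqVlt; apply/orP/or_introl/eqP; apply: eq_bigr => v _; ring.
Qed.

(** The batch step is the mean step [x1] minus alpha times the noise [N S]. The mean step gives the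
    factor [beta], the cross term averages to 0, and the noise variance, at most a multiple of
    |x|^2, is absorbed through c |x|^2 <= V. *)
Lemma energy_noisy_step {R : realType} {p n} (A : 'I_n -> 'M[R]_p) (b : nat)
    (alpha beta L c : R) (x y : 'cV[R]_p) :
  (2 <= n)%N -> (0 < b <= n)%N -> 0 < L ->
  (forall i, sym_psd (A i)) ->
  (forall i x, dot x (A i *m x) <= L * dot x x) ->
  let M := n%:R^-1 *: \sum_(i < n) A i in
  let s := (n%:R - b%:R) / ((n%:R - 1) * b%:R) in
  c * dot x x <= energy M alpha beta x y -> 0 < c ->
  \sum_(S : {set 'I_n}) batch_law R b S *
    energy M alpha beta
      (x - alpha *: batch_mean b (fun i => A i *m x) S + beta *: (x - y)) x
  <= (beta + alpha ^+ 2 * L ^+ 2 * s / c) * energy M alpha beta x y.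
Proof.
move=> n2 bn L0 pA AL M s cx c0; have [b0 b_n] := andP bn.
have sM : M^T = M.
  rewrite /M linearZ /= linear_sum; congr (_ *: _).
  by apply: eq_bigr => i _; have [] := pA i.
set v := fun i => A i *m x.
have vM : mean v = M *m x by rewrite /mean /M -scalemxAl mulmx_suml.
set x1 := x - alpha *: (M *m x) + beta *: (x - y).
set N := fun S => batch_mean b v S - mean v.
have xS S : x - alpha *: batch_mean b v S + beta *: (x - y) = x1 - alpha *: N S.
  rewrite /x1 /N vM; move: (batch_mean b v S) (M *m x) (beta *: _) => m d e.
  by rewrite scalerBr opprB [RHS]addrA [x - _ + e + _]addrAC subrK addrAC.
set Z := 2 *: x1 - ((1 + beta) *: x - alpha *: (M *m x)).
have -> : \sum_(S : {set 'I_n}) batch_law R b S *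
      energy M alpha beta (x - alpha *: batch_mean b v S + beta *: (x - y)) x
    = beta * energy M alpha beta x y * (\sum_(S : {set 'I_n}) batch_law R b S)
      + alpha ^+ 2 * (\sum_(S : {set 'I_n}) batch_law R b S * dot (N S) (N S))
      - alpha * (\sum_(S : {set 'I_n}) batch_law R b S * dot (N S) Z).
  rewrite !mulr_sumr -big_split -sumrB /=; apply: eq_bigr => S _.
  by rewrite xS energyB -/Z energy_step// dotZl [dot (N S) (_ *: _)]dotZr dotZl; ring.
rewrite batch_law_sum1// batch_mean_unbiased// mulr1 mulr0 subr0 mulrDl lerD2l.
have s0 : 0 <= s by rewrite divr_ge0 ?mulr_ge0 ?subr_ge0 ?ler_nat ?ler1n// ltnW.
have n0 : 0 < n%:R :> R by rewrite ltr0n ltnW.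
(* For each i, |A_i x|^2 <= L <x, A_i x> <= L^2 |x|^2. *)
have vx : n%:R^-1 * (\sum_(i < n) dot (v i) (v i)) <= L ^+ 2 * dot x x.
  rewrite ler_pdivrMl// mulr_natl -[n in leRHS]card_ord -sumr_const.
  apply: ler_sum => i _; apply: le_trans (psd_dot_sqr_le (pA i) L0 (AL i) x) _.
  by rewrite expr2 -mulrA ler_pM2l.
have := batch_mean_variance_le v n2 bn; rewrite -/s -/N => Nle.
apply: (@le_trans _ _ (alpha ^+ 2 * (s * (L ^+ 2 * dot x x)))).
  by rewrite ler_wpM2l ?sqr_ge0// (le_trans Nle)// ler_wpM2l.
rewrite -ler_pdivlMl// in cx.
have -> : alpha ^+ 2 * L ^+ 2 * s / c * energy M alpha beta x y
    = alpha ^+ 2 * (s * (L ^+ 2 * (c^-1 * energy M alpha beta x y))) by ring.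
by rewrite !ler_wpM2l ?sqr_ge0.
Qed.

(** * The rate and the final estimate *)

(** Applying 1 + t <= exp t to each factor, exp(-q/2)^2 exp(2qz) >= (1 - q/2)^2 (1 + 2qz). The
    surplus is at least qz/2, while q^2 z^4 <= qz/512. *)
Lemma contraction_le_expR (R : realType) (q z : R) :
  0 < q -> q <= 1 -> 0 <= z -> z <= 1 / 8 ->
  (1 - 2^-1 * q) ^+ 2 + 64 / 33 * q ^+ 2 * z ^+ 4
  <= expR (- (q * Num.max (3 / 4) (1 - 2 * z))).
Proof.
move=> q0 q1 z0 z1.
have -> : Num.max (3 / 4) (1 - 2 * z) = 1 - 2 * z by apply/max_idPr; lra.
have -> : - (q * (1 - 2 * z)) = - (2^-1 * q) + - (2^-1 * q) + 2 * q * z by field.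
rewrite 2!expRD -expr2.
have h1 := expR_ge1Dx (- (2^-1 * q)); have h2 := expR_ge1Dx (2 * q * z).
apply: (@le_trans _ _ ((1 - 2^-1 * q) ^+ 2 * (1 + 2 * q * z))); last first.
  by rewrite ler_pM ?sqr_ge0 ?lerXn2r ?nnegrE ?expR_ge0//; nra.
have qz : 0 <= q * z by rewrite mulr_ge0 // ltW.
have z3 : z ^+ 3 <= (1 / 8) ^+ 3 by rewrite lerXn2r ?nnegrE//; lra.
have h3 : q * (q * z) * z ^+ 3 <= q * z * (1 / 8) ^+ 3.
  apply: ler_pM => //; [by rewrite mulr_ge0// ltW|exact: exprn_ge0|].
  exact: ler_piMl.
have -> : 64 / 33 * q ^+ 2 * z ^+ 4 = 64 / 33 * (q * (q * z) * z ^+ 3) by ring.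
have h4 : (q * z) / 2 <= (1 - 2^-1 * q) ^+ 2 * (2 * q * z).
  have : (1 / 4) * (2 * (q * z)) <= (1 - 2^-1 * q) ^+ 2 * (2 * (q * z)).
    by rewrite ler_wpM2r ?mulr_ge0//; nra.
  lra.
rewrite mulrDr mulr1 lerD2l; apply: le_trans h4; lra.
Qed.

Theorem corollary1 (R : realType) (p n b : nat)
  (A : 'I_n -> 'M[R]_p) (c : 'I_n -> 'cV[R]_p)
  (f : 'I_n -> 'cV[R]_p -> R)
  (L mu kappa a alpha beta zeta : R) (w0 wstar : 'cV[R]_p)
  (disp : measure_display) (Om : measurableType disp) (P : probability Om R)
  (B : nat -> Om -> {set 'I_n}) (w : nat -> Om -> 'cV[R]_p)
  (hn : (2 <= n)%N)
  (hb : (b <= n)%N)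
  (hA : forall i, sym_psd (A i))
  (hf : forall i, f i = quadratic (A i) (c i))
  (hL : L = \big[Num.max/0]_(i < n) lambda_max (A i))
  (hmu : mu = lambda_min (n%:R^-1 *: \sum_(i < n) A i))
  (mu_gt0 : 0 < mu)
  (hkappa : kappa = L / mu)
  (hwstar : minimizer (finite_sum f) wstar)
  (interpolation : forall i, gradient (f i) wstar = 0)
  (a_gt0 : 0 < a) (a_le1 : a <= 1)
  (halpha : alpha = a / L)
  (hbeta : beta = (1 - 2^-1 * Num.sqrt (alpha * mu)) ^+ 2)
  (hbatch : n%:R * (1 / (1 + (n%:R - 1) / ((3 ^+ 5 * 2 ^+ 6) * kappa ^+ 2)))
            <= b%:R)
  (hzeta : zeta = Num.sqrt (3 * ((n%:R - b%:R) / ((n%:R - 1) * b%:R))))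
  (hB : minibatch_sampling P b B)
  (hw : forall k om,
    w k om =
    heavy_ball (fun j => batch_gradient f b (B j om)) alpha beta w0 k) :
  forall T : nat, (1 <= T)%N ->
    ('E_P[(fun om => l2norm (w T om - wstar))%R] <=
     (6 * Num.sqrt 2 / Num.sqrt a * Num.sqrt kappa
      * expR (- (T%:R / Num.sqrt kappa * (Num.sqrt a / 2)
                 * Num.max (3 / 4) (1 - 2 * Num.sqrt kappa * Num.sqrt zeta)))
      * l2norm (w0 - wstar))%:E)%E.
Proof.
move=> T _.
have n0 : 0 < n%:R :> R by rewrite ltr0n ltnW.
have sA i : (A i)^T = A i by have [] := hA i.
set M := n%:R^-1 *: \sum_(i < n) A i in hmu.
have sM : M^T = M.
  by rewrite /M linearZ /= linear_sum; congr (_ *: _); apply: eq_bigr => i _; exact: sA.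
have AL i x : dot x (A i *m x) <= L * dot x x.
  apply: le_trans (lambda_max_ge (sA i) x) _; rewrite ler_wpM2r ?dot_ge0// hL.
  exact: (le_bigmax _ (fun i => lambda_max (A i))).
have ME x : dot x (M *m x) = n%:R^-1 * \sum_(i < n) dot x (A i *m x).
  by rewrite /M -scalemxAl dotZr mulmx_suml dot_sumr.
have ML x : dot x (M *m x) <= L * dot x x.
  rewrite ME ler_pdivrMl// mulr_natl -[n in leRHS]card_ord -sumr_const.
  exact: ler_sum.
have muM x : mu * dot x x <= dot x (M *m x) by rewrite hmu; exact: lambda_min_le.
have pM : sym_psd M.
  split=> // x; rewrite -mulmxA; apply: le_trans (muM x).
  by rewrite mulr_ge0 ?dot_ge0// ltW.
(* In dimension 0 the spectrum is empty and its [inf] is 0, against mu > 0. *)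
have p0 : (0 < p)%N.
  rewrite lt0n; apply/negP => /eqP p0; subst p.
  have : mu = 0; last by move=> mu0; rewrite mu0 ltxx in mu_gt0.
  rewrite hmu /lambda_min -[RHS](@inf0 R); congr inf.
  by apply/seteqP; split=> // l /= /eigenvalueP[v _]; rewrite thinmx0 eqxx.
have muL : mu <= L.
  pose e : 'cV[R]_p := const_mx 1.
  have e0 : e != 0.
    by apply/eqP => /colP/(_ (Ordinal p0)); rewrite !mxE => /eqP; rewrite oner_eq0.
  by rewrite -(ler_pM2r (dot_gt0 e0)); apply: le_trans (muM e) (ML e).
have L0 : 0 < L by exact: lt_le_trans muL.
have k1 : 1 <= kappa by rewrite hkappa ler_pdivlMr// mul1r.
have k0 : 0 < kappa by exact: lt_le_trans k1.
have al0 : 0 < alpha by rewrite halpha divr_gt0.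
set s := (n%:R - b%:R) / ((n%:R - 1) * b%:R) in hzeta.
have n10 : 0 < n%:R - 1 :> R by rewrite subr_gt0 ltr1n.
(* The batch condition becomes n <= b (1 + t), which yields both b > 0 and n - b <= b t. *)
pose t : R := (n%:R - 1) / ((3 ^+ 5 * 2 ^+ 6) * kappa ^+ 2).
have t0 : 0 < t by rewrite divr_gt0// mulr_gt0 ?exprn_gt0// mulr_gt0 ?exprn_gt0.
have t1 : 0 < 1 + t by rewrite addr_gt0.
rewrite -/t mulrA mulr1 ler_pdivrMr// in hbatch.
have b0 : 0 < b%:R :> R.
  by rewrite -(pmulr_lgt0 _ t1); exact: lt_le_trans hbatch.
have bn : (0 < b <= n)%N by rewrite hb -(ltr0n R) b0.
have s0 : 0 <= s.
  by rewrite divr_ge0 ?subr_ge0 ?ler_nat// mulr_ge0// ltW.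
(* Here 15552 = 3^5 2^6. *)
have sk : s * kappa ^+ 2 <= 1 / 15552.
  have -> : s * kappa ^+ 2 = (n%:R - b%:R) * (kappa ^+ 2 / ((n%:R - 1) * b%:R)).
    by rewrite /s mulrAC -mulrA.
  have -> : 1 / 15552 = b%:R * t * (kappa ^+ 2 / ((n%:R - 1) * b%:R)) :> R.
    by rewrite /t; field; rewrite !lt0r_neq0.
  rewrite ler_wpM2r//; first by rewrite divr_ge0 ?sqr_ge0// mulr_ge0// ltW.
  by rewrite lerBlDl -[X in X + _]mulr1 -mulrDr.
have zeta2 : zeta ^+ 2 = 3 * s by rewrite hzeta sqr_sqrtr// mulr_ge0.
have zeta0 : 0 <= zeta by rewrite hzeta sqrtr_ge0.
(* Squared, this is 3 s kappa^2 <= 3 / 15552 = 1 / 72^2. *)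
have kz : kappa * zeta <= 1 / 72.
  rewrite -(@ler_pXn2r _ 2) ?nnegrE ?divr_ge0 ?mulr_ge0 ?(ltW k0)//.
  have -> : (1 / 72) ^+ 2 = 3 * (1 / 15552) :> R by field.
  by rewrite exprMn zeta2 mulrCA ler_pM2l// mulrC.
set z := Num.sqrt kappa * Num.sqrt zeta.
have z0 : 0 <= z by rewrite mulr_ge0 ?sqrtr_ge0.
have z2 : z ^+ 2 = kappa * zeta by rewrite exprMn !sqr_sqrtr// ltW.
have z8 : z <= 1 / 8.
  rewrite -(@ler_pXn2r _ 2) ?nnegrE ?divr_ge0// z2; apply: le_trans kz _.
  by rewrite expr_div_n expr1n ler_pM2l// lef_pV2 ?posrE ?exprn_gt0// -natrX ler_nat.
set q := Num.sqrt (alpha * mu) in hbeta.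
have q2 : q ^+ 2 = a / kappa.
  rewrite sqr_sqrtr ?mulr_ge0 ?ltW// halpha hkappa.
  by field; rewrite !lt0r_neq0.
have qE : q = Num.sqrt a / Num.sqrt kappa.
  apply/eqP; rewrite -(@eqrXn2 _ 2) ?sqrtr_ge0 ?divr_ge0 ?sqrtr_ge0//.
  by rewrite q2 expr_div_n !sqr_sqrtr// ltW.
have q0 : 0 < q by rewrite qE divr_gt0 ?sqrtr_gt0.
have q1 : q <= 1.
  rewrite -(@ler_pXn2r _ 2) ?nnegrE ?(ltW q0)// expr1n q2 ler_pdivrMr// mul1r.
  exact: le_trans k1.
pose c0 := 11 / 64 * q ^+ 2.
have c00 : 0 < c0 by rewrite mulr_gt0 ?exprn_gt0// divr_gt0.
have aM u : alpha * dot u (M *m u) <= dot u u.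
  rewrite halpha mulrAC ler_pdivrMr//.
  apply: le_trans (ler_wpM2l (ltW a_gt0) (ML u)) _.
  by rewrite [leRHS]mulrC; apply: ler_piMl; rewrite ?mulr_ge0 ?dot_ge0 ?(ltW L0).
have coer x y : c0 * dot x x <= energy M alpha beta x y.
  rewrite hbeta; apply: energy_coercive => // u.
  by rewrite sqr_sqrtr ?mulr_ge0 ?(ltW al0) ?(ltW mu_gt0)// -mulrA ler_pM2l.
pose rho := beta + alpha ^+ 2 * L ^+ 2 * s / c0.
(* Uses alpha L = a = q^2 kappa and z^4 = kappa^2 zeta^2 = 3 s kappa^2; 64/33 is 64/11 divided by
   3. *)
have rhoE : rho = (1 - 2^-1 * q) ^+ 2 + 64 / 33 * q ^+ 2 * z ^+ 4.
  rewrite /rho hbeta; congr (_ + _).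
  have -> : z ^+ 4 = kappa ^+ 2 * (3 * s) by rewrite -zeta2 -exprMn -z2 -exprM.
  have -> : alpha ^+ 2 * L ^+ 2 = (q ^+ 2 * kappa) ^+ 2.
    by rewrite -exprMn halpha q2 !divfK// lt0r_neq0.
  by rewrite /c0; field; rewrite lt0r_neq0.
have rho0 : 0 <= rho.
  by rewrite rhoE addr_ge0 ?sqr_ge0// mulr_ge0 ?exprn_ge0// mulr_ge0 ?sqr_ge0// divr_ge0.
have rhole := contraction_le_expR q0 q1 z0 z8; rewrite -rhoE in rhole.
(* Interpolation means c_i = A_i w^*, so every gradient is linear in the error and the noise
   vanishes at w^*. *)
have gradE S x : batch_gradient f b S x = batch_mean b (fun i => A i *m (x - wstar)) S.
  rewrite /batch_gradient /batch_mean; congr (_ *: _); apply: eq_bigr => i _.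
  have := interpolation i; rewrite hf !gradient_quadratic// => /eqP.
  by rewrite subr_eq0 => /eqP <-; rewrite mulmxBr.
pose st (S : seq {set 'I_n}) :=
  heavy_ball_state (fun j => batch_gradient f b (nth finset.set0 S j)) alpha beta w0 T.
pose F S := l2norm ((st S).1 - wstar).
have -> : (fun om => l2norm (w T om - wstar)) = (fun om => F (mkseq (B^~ om) T)).
  apply/funext => om; rewrite hw /F /st; congr (l2norm (_.1 - _)).
  by apply: heavy_ball_state_ext => j jT; rewrite nth_mkseq.
have [mB uB iB] := hB.
rewrite (expectation_words (u := batch_law R b) finset.set0)//; last first.
  by move=> S; exact: sqrtr_ge0.
rewrite lee_fin.
have law0 := @batch_law_ge0 R n b.
have law1 := @batch_law_sum1 R n b hb.
set m := \sum_(S <- _) _.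
(* The chain is c0 E|e_T|^2 <= E V <= rho^T V(e_0, e_0) <= rho^T |e_0|^2, the last step by alpha M
   <= I. *)
have m2 : m ^+ 2 <= c0^-1 * (rho ^+ T * dot (w0 - wstar) (w0 - wstar)).
  apply: le_trans (sum_words_sqr _ _ law0 law1) _.
  have := @heavy_ball_supermartingale R p _ finset.set0 (batch_law R b)
    (batch_gradient f b) (fun x y => energy M alpha beta (x - wstar) (y - wstar))
    alpha beta rho w0 law0 rho0.
  have step x y : \sum_(S : {set 'I_n}) batch_law R b S *
      energy M alpha beta (x - alpha *: batch_gradient f b S x + beta *: (x - y) - wstar)
        (x - wstar) <= rho * energy M alpha beta (x - wstar) (y - wstar).
    have := @energy_noisy_step R p n A b alpha beta L c0 (x - wstar) (y - wstar)
      hn bn L0 hA AL (coer _ _) c00; rewrite -/M -/s -/rho; apply: le_trans.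
    rewrite le_eqVlt; apply/orP/or_introl/eqP; apply: eq_bigr => S _.
    congr (_ * energy _ _ _ _ _); rewrite gradE opprB addrA subrK.
    by rewrite addrAC; congr (_ + _); rewrite addrAC.
  move=> /(_ step T) /= H.
  rewrite -(ler_pM2l c00) mulrA divff ?lt0r_neq0// mul1r.
  apply: (le_trans _ (le_trans H _)).
    rewrite mulr_sumr; apply: ler_sum => S _; rewrite mulrA.
    by rewrite ler_wpM2r ?prodr_ge0// l2norm_sqr coer.
  rewrite ler_wpM2l ?exprn_ge0// energy_diag.
  exact: aM.
rewrite /z mulrA in rhole.
set mx := Num.max _ _ in rhole *.
(* Squaring cancels the 1/2 in the exponent, leaving T factors exp(-q mx). *)
have eE : expR (- (T%:R / Num.sqrt kappa * (Num.sqrt a / 2) * mx)) ^+ 2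
    = expR (- (q * mx)) ^+ T.
  rewrite -!expRM_natl; congr expR; rewrite qE.
  by field; rewrite lt0r_neq0// sqrtr_gt0.
rewrite -(@ler_pXn2r _ 2) ?nnegrE//; last 2 first.
- by apply: sumr_ge0 => S _; rewrite mulr_ge0 ?sqrtr_ge0 ?prodr_ge0.
- by rewrite !mulr_ge0 ?invr_ge0 ?sqrtr_ge0 ?expR_ge0.
apply: le_trans m2 _.
rewrite [leRHS]exprMn l2norm_sqr exprMn eE mulrA ler_wpM2r ?dot_ge0//.
rewrite !exprMn exprVn !sqr_sqrtr ?(ltW a_gt0) ?(ltW k0)//.
apply: ler_pM; rewrite ?invr_ge0 ?(ltW c00) ?exprn_ge0//; last first.
  by rewrite lerXn2r ?nnegrE ?expR_ge0.
(* It remains to compare prefactors: 64/11 against 72 = (6 sqrt 2)^2, both times kappa / a. *)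
have -> : c0^-1 = 64 / 11 * (kappa / a).
  by rewrite /c0 q2; field; rewrite !lt0r_neq0.
have -> : 6 ^+ 2 * 2 * a^-1 * kappa = 72 * (kappa / a) :> R by ring.
rewrite ler_wpM2r ?divr_ge0 ?(ltW a_gt0) ?(ltW k0)//.
by rewrite ler_pdivrMr// -natrM ler_nat.
Qed.
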